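(* Let $G$ be a finitely presented group, and set $n_p=b_1^{(p)}(G)$ for $p=2,3$. Then the numbers $a_2(G)$ and $a_3(G)$ of index $2$ and index $3$ subgroups of $G$ are given by $$a_2(G)=2^{n_2}-1,\qquad a_3(G)=\tfrac12\left(3^{n_3}-1\right)+\tfrac32\sum_{d\ge1}\beta_{2,d}^{(3)}(G)\,(3^d-1).$$
   Context: For a prime $q$, $b_1^{(q)}(G)=\dim_{\mathbb{F}_q}H_1(G;\mathbb{F}_q)$. $a_k(G)$ is the number of index $k$ subgroups of $G$ (as subgroups, not up to conjugacy). $\beta_{2,d}^{(3)}(G)$ is the number of index $2$ (normal) subgroups $K\triangleleft G$ with $b_1^{(3)}(K)=b_1^{(3)}(G)+d$. *)

(* Defs.v *)
From HB Require Import structures.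
From mathcomp Require Import all_boot all_order all_algebra.
From mathcomp Require Import finmap all_classical.
From mathcomp Require Export freeg.

Set Implicit Arguments.
Unset Strict Implicit.
Unset Printing Implicit Defensive.

Import GRing.Theory.

Local Open Scope classical_set_scope.
Local Open Scope ring_scope.

(* Words in the letters x_i and x_i^-1; the letter (i, b) stands for x_i if
   b = false and for x_i^-1 if b = true. *)
Definition word (n : nat) : Type := seq ('I_n * bool).

(* Equality in the group < x_0, ..., x_(n-1) | rels >: that group is the
   quotient of the monoid of words by this congruence. *)
Inductive presented_eq (n : nat) (rels : seq (word n)) :
    word n -> word n -> Prop :=
| presented_refl u : presented_eq rels u u
| presented_sym u v : presented_eq rels u v -> presented_eq rels v u
| presented_trans u v w :
    presented_eq rels u v -> presented_eq rels v w -> presented_eq rels u w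
| presented_cat u u' v v' :
    presented_eq rels u u' -> presented_eq rels v v' ->
    presented_eq rels (u ++ v) (u' ++ v')
| presented_cancel i b : presented_eq rels [:: (i, b); (i, ~~ b)] [::]
| presented_rel r : r \in rels -> presented_eq rels r [::].

Definition word_eval (G : groupType) (n : nat) (g : 'I_n -> G) (w : word n) : G :=
  (\prod_(x <- w) (if x.2 then (g x.1)^-1 else g x.1))%g.

(* Evaluation at g induces an isomorphism from a finitely presented group
   onto G. *)
Definition finitely_presented (G : groupType) : Prop :=
  exists (n : nat) (rels : seq (word n)) (g : 'I_n -> G),
    (forall x : G, exists w, word_eval g w = x) /\
    (forall u v, word_eval g u = word_eval g v <-> presented_eq rels u v).

(* v_0, ..., v_(n-1) in Z represent a basis of the quotient Z / (Z `&` B). *)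
Definition quotient_basis (F : fieldType) (V : lmodType F) (Z B : set V)
    (n : nat) (v : 'I_n -> V) : Prop :=
  (forall i, Z (v i)) /\
  (forall z, Z z ->
     exists! c : {ffun 'I_n -> F}, B (z - \sum_i c i *: v i)).

(* The dimension of Z / (Z `&` B); it is 0 by convention when that quotient has
   infinite dimension, which does not occur for H_1 of a finitely generated
   group. *)
Definition quotient_dim (F : fieldType) (V : lmodType F) (Z B : set V) : nat :=
  xget 0%N [set n | exists v : 'I_n -> V, quotient_basis Z B v].

(* The bar complex of G with trivial coefficients F, in degrees at most 2:
   d [g|h] = [h] - [gh] + [g] and d [g] = [] - [] = 0. *)
Section BarComplex.
Variables (F : fieldType) (G : groupType).

Definition bar_d1 : {freeg G / F} -> F^o :=
  fglift (fun=> 1 - 1 : F^o).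

Definition bar_d2 : {freeg (G * G)%type / F} -> {freeg G / F} :=
  fglift (fun p => << p.2 >> - << (p.1 * p.2)%g >> + << p.1 >>).

Definition H1_cycles : set {freeg G / F} := [set c | bar_d1 c = 0].

Definition H1_boundaries : set {freeg G / F} := range bar_d2.

Definition H1_dim : nat := quotient_dim H1_cycles H1_boundaries.

End BarComplex.

(* 'F_q is the field with q elements only for q prime. *)
Definition b1 (q : nat) (G : groupType) : nat := H1_dim 'F_q G.

Record subgroup (G : groupType) := Subgroup {
  subgroup_set : set G;
  subgroup_closed : group_closed (mem subgroup_set) }.

HB.instance Definition _ (G : groupType) := gen_eqMixin (subgroup G).
HB.instance Definition _ (G : groupType) := gen_choiceMixin (subgroup G).

Definition subgroup_type (G : groupType) (K : subgroup G) : Type :=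
  {x : G | x \in subgroup_set K}.

HB.instance Definition _ (G : groupType) (K : subgroup G) :=
  SubChoice.on (subgroup_type K).
HB.instance Definition _ (G : groupType) (K : subgroup G) :=
  SubChoice_isSubGroup.Build
    G (mem (subgroup_set K)) (subgroup_type K) (subgroup_closed K).

Definition left_cosets (G : groupType) (K : subgroup G) : set (set G) :=
  [set [set (x * h)%g | h in subgroup_set K] | x in [set: G]].

Definition has_index (G : groupType) (k : nat) (K : subgroup G) : Prop :=
  (left_cosets K #= `I_k)%card.

Definition normal_subgroup (G : groupType) (K : subgroup G) : Prop :=
  forall x y : G, subgroup_set K x -> subgroup_set K (x ^ y)%g.

(* A finitely generated group has finitely many subgroups of index k, so below
   fset_set is applied to finite sets whenever G is finitely generated. *)
Definition num_index (k : nat) (G : groupType) : nat :=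
  #|` fset_set [set K : subgroup G | has_index k K] |.

Definition beta (q k d : nat) (G : groupType) : nat :=
  #|` fset_set [set K : subgroup G |
        [/\ normal_subgroup K, has_index k K
          & b1 q (subgroup_type K) = (b1 q G + d)%N] ] |.

(* Main.v *)
From HB Require Import structures.
Require Import Defs.
From mathcomp Require Import all_boot all_order all_algebra.
From mathcomp Require Import finmap all_classical.
From mathcomp Require Import ring lra.

(** The cosets of an index 3 subgroup H of G can be labelled by 'F_3, with H
    itself labelled 0.  Left multiplication by x permutes the labels, and every
    permutation of a set of three elements is affine over 'F_3; so the label
    map phi : G -> 'F_3 satisfies phi (x * y) = phi x + eps x * phi y for a
    sign character eps of G.  Thus H is the zero set of a surjective map phi
    that is a cocycle for some eps, and the only other such map with the same
    zero set is - phi ([index3_fiber]).  The number of these maps is therefore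
    twice the number of index 3 subgroups ([card_affine_onto]).

    The same maps can be sorted by the kernel K of eps ([sign_fiber]).  For
    K = G they are the nonzero homomorphisms to 'F_3, and there are
    3 ^ b1(G) - 1 of them.  When K has index 2, fix t outside K.  As 2 is
    invertible in 'F_3, Hom(K, 'F_3) is the sum of its invariant and its
    anti-invariant part under conjugation by t.  Restriction identifies the
    invariant part with Hom(G, 'F_3), and the anti-invariant part with the
    cocycles modulo those that vanish on K; the latter are given by their
    value at t, which is arbitrary.  The inverse of this identification is the
    transfer.  Hence |Hom(G, 'F_3)| * |cocycles| =
    |Hom(K, 'F_3)| * 3 ([cochain_sum_bij]), and there are 3 * 3 ^ d cocycles,
    where d = b1(K) - b1(G).  The three that vanish on K are the ones that are
    not surjective ([card_twisted_onto]).  Summing over K gives the formula.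

    Betti numbers enter only through |Hom(G, 'F_q)| = q ^ b1(G)
    ([card_additive_maps]): a homomorphism is determined by arbitrary values
    on a basis of H_1.  That a finite basis exists uses finite generation,
    which passes to subgroups of index 2 by Schreier's argument
    ([index2_generated]).  Finally, an index 2 subgroup is the kernel of
    exactly one nonzero homomorphism to 'F_2, by the same labelling argument
    ([card_index2]). *)

Set Implicit Arguments.
Unset Strict Implicit.
Unset Printing Implicit Defensive.

Import GRing.Theory.

Local Open Scope classical_set_scope.
Local Open Scope card_scope.
Local Open Scope ring_scope.

(** * Counting by fibers *)

Lemma set_bij_card (T U : Type) (A : set T) (B : set U) f : set_bij A B f -> A #= B.
Proof.
by move=> bij_f; have [g] := bijPex.2 (ex_intro _ f bij_f); exact: pcard_eq.
Qed.

Lemma card_finType (T : finType) : [set: T] #= `I_#|T|.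
Proof.
apply: (@set_bij_card _ _ _ _ (fun x => enum_rank x : nat)).
split=> [x _ | x y _ _ /ord_inj/enum_rank_inj //| i /= i_lt].
  exact: ltn_ord.
by exists (enum_val (Ordinal i_lt)) => //; rewrite enum_valK.
Qed.

Lemma card_fset_setK (T : choiceType) (A : set T) :
  finite_set A -> A #= `I_#|` fset_set A|.
Proof. by move=> /finite_setP[n An]; rewrite (card_fset_set An). Qed.

Lemma sum_fiber (T U : choiceType) (A : set T) (h : T -> U) y : finite_set A ->
  (\sum_(x <- fset_set A) (h x == y))%N = #|` fset_set (A `&` h @^-1` [set y])|.
Proof.
move=> finA; rewrite -big_mkcond sum1_count -size_filter.
apply: perm_size; apply: uniq_perm; rewrite ?filter_uniq ?fset_uniq // => x.
rewrite mem_filter !in_fset_set //; last exact: finite_setIl.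
apply/andP/idP => [[/eqP hx /set_mem Ax]|/set_mem[Ax hx]].
  by rewrite inE.
by split; [apply/eqP | rewrite inE].
Qed.

Lemma card_fibers (T U : choiceType) (A : set T) (B : set U) (h : T -> U)
    (m : U -> nat) : finite_set B -> (forall x, A x -> B (h x)) ->
    (forall y, B y -> A `&` h @^-1` [set y] #= `I_(m y)) ->
  A #= `I_(\sum_(y <- fset_set B) m y).
Proof.
move=> finB hAB fib.
have finA : finite_set A.
  apply: (sub_finite_set (B := \bigcup_(y in B) (A `&` h @^-1` [set y]))).
    by move=> x Ax; exists (h x); [exact: hAB | ].
  by apply: bigcup_finite => // y /fib ?; apply/finite_setP; exists (m y).
suff <- : #|` fset_set A| = (\sum_(y <- fset_set B) m y)%N by exact: card_fset_setK.
rewrite card_fset_sum1.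
transitivity (\sum_(x <- fset_set A) \sum_(y <- fset_set B) (h x == y : nat))%N.
  apply: eq_big_seq => x; rewrite in_fset_set // => /set_mem Ax.
  rewrite (bigD1_seq (h x)) ?fset_uniq ?in_fset_set ?mem_set //=; last exact: hAB.
  rewrite eqxx big1 ?addn0 // => y; by rewrite eq_sym => /negPf ->.
rewrite exchange_big; apply: eq_big_seq => y; rewrite in_fset_set // => /set_mem By.
by rewrite sum_fiber // (card_fset_set (fib y By)).
Qed.

Lemma card_fibers_const (T U : choiceType) (A : set T) (B : set U) (h : T -> U)
    m n : B #= `I_n -> (forall x, A x -> B (h x)) ->
    (forall y, B y -> A `&` h @^-1` [set y] #= `I_m) ->
  A #= `I_(n * m).
Proof.
move=> Bn hAB fib; have finB : finite_set B by apply/finite_setP; exists n.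
have := card_fibers (m := fun=> m) finB hAB fib.
by rewrite big_const_seq count_predT (card_fset_set Bn) iter_addn_0 mulnC.
Qed.

Lemma card_setX_II (T U : choiceType) (A : set T) (B : set U) m n :
  A #= `I_m -> B #= `I_n -> A `*` B #= `I_(m * n).
Proof.
move=> Am Bn; apply: (card_fibers_const (h := fst) Am) => [[x y] [] // | x Ax].
apply: card_eq_trans Bn; apply: card_esym.
apply: (@set_bij_card _ _ _ _ (fun y => (x, y))).
split=> [y By | y z _ _ [] // | [x' y] [[_ By] /= <-]]; first by [].
by exists y.
Qed.

Lemma card_setD_II (T : choiceType) (A B : set T) m n :
  A #= `I_m -> B #= `I_n -> B `<=` A -> A `\` B #= `I_(m - n).
Proof.
move=> Am Bn BA.
have finA : finite_set A by apply/finite_setP; exists m.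
have finB : finite_set B by apply/finite_setP; exists n.
have <- : #|` fset_set (A `\` B)| = (m - n)%N; last first.
  by apply: card_fset_setK; exact: finite_setD.
rewrite fset_setD // cardfsDS ?(card_fset_set Am) ?(card_fset_set Bn) //.
by rewrite -fset_set_sub.
Qed.

(** The index set on the left is infinite; only the finitely many values taken
    by f on A contribute, and the excluded value 0 is harmless because of
    g 0 = 0. *)
Lemma fsum_by_value (R : nzRingType) (T : choiceType) (A : set T)
    (f : T -> nat) (g : nat -> R) :
  finite_set A -> g 0%N = 0 ->
  \sum_(d \in [set d | (1 <= d)%N])
     #|` fset_set [set x | A x /\ f x = d]|%:R * g d
  = \sum_(x <- fset_set A) g (f x).
Proof.
move=> finA g0; pose N := (\max_(x <- fset_set A) f x).+1.
have fN x : x \in fset_set A -> (f x < N)%N.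
  by move=> xA; rewrite ltnS; exact: leq_bigmax_seq.
rewrite (fsbig_widen _ setT) //; last first.
  by move=> [|d] [_ //= _]; rewrite g0 mulr0.
rewrite -(fsbig_widen `I_N) //; last first.
  move=> d [_ /= dN]; suff -> : [set x | A x /\ f x = d] = set0.
    by rewrite fset_set0 cardfs0 mul0r.
  rewrite -subset0 => x [Ax fx]; apply: dN; rewrite /= -fx; apply: fN.
  by rewrite in_fset_set // mem_set.
rewrite -fsbig_ord.
transitivity (\sum_(x <- fset_set A) \sum_(d < N) (f x == d)%:R * g d).
  rewrite exchange_big; apply: eq_bigr => d _ /=.
  by rewrite -mulr_suml -natr_sum sum_fiber.
apply: eq_big_seq => x /fN xN; rewrite (bigD1 (Ordinal xN)) //= eqxx mul1r.
rewrite big1 ?addr0 // => d; rewrite -val_eqE /= eq_sym => /negPf ->.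
by rewrite mul0r.
Qed.

(** * First homology and additive maps *)

Section FreeModules.
Variables (F : fieldType) (K : choiceType) (V : lmodType F).

Lemma fglift_is_linear (f : K -> V) : linear (fglift f : {freeg K / F} -> V).
Proof.
have sub := lift_is_additive f.
pose m := GRing.isAdditive.Build _ _ _ sub.
pose h : {additive {freeg K / F} -> V} := HB.pack (fglift f) m.
have hE u : h u = fglift f u by [].
have sumE u : h u = \sum_(x <- dom u) coeff x u *: f x.
  rewrite -{1}(freeg_sumE u) raddf_sum.
  by apply: eq_bigr => x _; rewrite hE liftU.
move=> c u v; rewrite -!hE raddfD; congr (_ + _).
rewrite -[c *: u]/(fgscale c u) raddf_sum sumE scaler_sumr.
by apply: eq_bigr => x _; rewrite hE liftU scalerA.
Qed.

HB.instance Definition _ (f : K -> V) :=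
  GRing.isLinear.Build F {freeg K / F} V *:%R (fglift f) (fglift_is_linear f).

Lemma freeg_expand (z : {freeg K / F}) : z = \sum_(x <- dom z) coeff x z *: << x >>.
Proof.
rewrite -[LHS]freeg_sumE; apply: eq_bigr => x _.
by apply/eqP/freeg_eqP => y; rewrite coeffZ !coeffU mul1r.
Qed.

End FreeModules.

Section Quotients.
Variables (F : fieldType) (V : lmodType F) (B : set V).
Hypothesis (BL : forall c u v, B u -> B v -> B (c *: u + v)).

Definition spans_mod n (v : 'I_n -> V) :=
  forall z, exists c : 'I_n -> F, B (z - \sum_i c i *: v i).

(** A spanning family of minimal length is a basis: two different coordinate
    vectors of the same element give a nontrivial relation, by which one
    member of the family can be removed. *)
Lemma quotient_basis_exists n (v : 'I_n -> V) :
  spans_mod v -> exists m (w : 'I_m -> V), quotient_basis setT B w.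
Proof.
move=> v_span.
have exP : exists m, `[< exists w : 'I_m -> V, spans_mod w >].
  by exists n; apply/asboolP; exists v.
case: (ex_minnP exP) => m /asboolP[w w_span] m_min.
exists m, w; split=> // z _; have [c Bc] := w_span z.
exists [ffun i => c i]; split.
  by under eq_bigr do rewrite ffunE.
move=> c' Bc'; apply/ffunP => j; rewrite ffunE.
apply/eqP/negP => /negP c_neq.
case: m w w_span m_min c Bc c' Bc' j c_neq => [|m] w w_span m_min c Bc c' Bc' j c_neq.
  by case: j c_neq => [[]].
pose d i := c i - c' i.
have d_neq0 : d j != 0 by rewrite subr_eq0.
have Bd : B (\sum_i d i *: w i).
  have -> : \sum_i d i *: w i =
      (-1) *: (z - \sum_i c i *: w i) + (z - \sum_i c' i *: w i).
    rewrite scaleN1r opprB addrA subrK -sumrB.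
    by apply: eq_bigr => i _; rewrite scalerBl.
  exact: BL.
suff : (m.+1 <= m)%N by rewrite ltnn.
apply: m_min; apply/asboolP; exists (w \o lift j) => y.
have [e Be] := w_span y.
(* Replace w j by its expression through the relation, whose coefficient d j
   at w j is nonzero. *)
exists (fun i => e (lift j i) - e j / d j * d (lift j i)).
have := BL (e j / d j) Bd Be; congr B.
under [in RHS]eq_bigr do rewrite scalerBl -scalerA.
rewrite sumrB -scaler_sumr !(bigD1_ord j) //= scalerDr scalerA divfK //.
rewrite opprD !opprB addrC -!addrA; congr (_ + _).
by rewrite addrCA addKr addrC.
Qed.

End Quotients.

Definition additive_maps (G : groupType) (M : zmodType) : set (G -> M) :=
  [set f | forall x y, f (x * y)%g = f x + f y].

Arguments additive_maps : clear implicits.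

Section AdditiveMaps.
Variables (G : groupType) (M : zmodType) (f : G -> M).
Hypothesis f_add : additive_maps G M f.

Lemma additive_map1 : f 1%g = 0.
Proof. by apply: (addrI (f 1%g)); rewrite addr0 -f_add mulg1. Qed.

Lemma additive_mapV x : f x^-1%g = - f x.
Proof. by apply/eqP; rewrite -addr_eq0 -f_add mulVg additive_map1. Qed.

End AdditiveMaps.

(** Generation as a monoid, which makes inductions shorter; finite generation
    does not depend on the choice, since a finite family of group generators
    can be closed under inverses. *)
Definition generated_by (G : groupType) (I : Type) (g : I -> G) :=
  forall x, exists w : seq I, x = (\prod_(i <- w) g i)%g.

Definition finitely_generated (G : groupType) :=
  exists (I : finType) (g : I -> G), generated_by g.

Lemma presented_generated (G : groupType) :
  finitely_presented G -> finitely_generated G.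
Proof.
move=> [n [rels [g [g_gen _]]]].
exists ('I_n * bool)%type, (fun l => if l.2 then (g l.1)^-1%g else g l.1) => x.
by have [w <-] := g_gen x; exists w.
Qed.

Section FirstHomology.
Variables (F : fieldType) (G : groupType).

Local Notation chains := {freeg G / F}.
Local Notation bounds := (@H1_boundaries F G).

Lemma H1_cyclesE : @H1_cycles F G = setT.
Proof.
apply/seteqP; split=> // z _; rewrite /H1_cycles /= /bar_d1.
rewrite [z]freeg_expand linear_sum big1 // => x _.
by rewrite linearZ /= liftU subrr !scaler0.
Qed.

Lemma bounds_linear c (u v : chains) : bounds u -> bounds v -> bounds (c *: u + v).
Proof.
move=> [a _ <-] [b _ <-]; exists (c *: a + b) => //.
by rewrite /bar_d2 linearP.
Qed.

Lemma bounds0 : bounds (0 : chains).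
Proof. by exists 0 => //; rewrite /bar_d2 linear0. Qed.

Lemma boundsZ c (u : chains) : bounds u -> bounds (c *: u).
Proof. by move=> Bu; rewrite -[_ *: _]addr0; exact: bounds_linear bounds0. Qed.

Lemma boundsD (u v : chains) : bounds u -> bounds v -> bounds (u + v).
Proof. by move=> Bu; rewrite -[u]scale1r; exact: bounds_linear. Qed.

Lemma bounds_mul x y : bounds (<< y >> - << (x * y)%g >> + << x >> : chains).
Proof. by exists << (x, y) >> => //; rewrite /bar_d2 liftU scale1r. Qed.

(** The linear extension of a homomorphism is a cocycle of the bar complex. *)
Lemma bounds_vanish (V : lmodType F) (f : G -> V) (u : chains) :
  additive_maps G V f -> bounds u -> fglift f u = 0.
Proof.
move=> f_add [a _ <-]; rewrite [a]freeg_expand /bar_d2 !linear_sum big1 //= => p _.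
rewrite !linearZ /= liftU scale1r linearD linearB /= !liftU !scale1r f_add.
by rewrite opprD addrCA subrr addr0 addNr scaler0.
Qed.

Lemma spans_mod_sum (T : Type) (r : seq T) (z : T -> chains) n (v : 'I_n -> chains) :
  (forall x, exists c : 'I_n -> F, bounds (z x - \sum_i c i *: v i)) ->
  exists c : 'I_n -> F, bounds (\sum_(x <- r) z x - \sum_i c i *: v i).
Proof.
move=> z_span; elim: r => [|x r [c Bc]].
  exists (fun=> 0); rewrite big_nil big1 ?subr0; first exact: bounds0.
  by move=> i _; rewrite scale0r.
have [d Bd] := z_span x.
exists (fun i => d i + c i); rewrite big_cons.
under [X in _ - X]eq_bigr do rewrite scalerDl.
by rewrite big_split opprD addrACA; exact: boundsD.
Qed.

(** The class of a product is the sum of the classes of its factors. *)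
Lemma generators_span (I : finType) (g : I -> G) :
  generated_by g -> spans_mod bounds (fun i : 'I_#|I| => << g (enum_val i) >>).
Proof.
move=> g_gen; set v := (X in spans_mod _ X) => z.
rewrite [z]freeg_expand; apply: spans_mod_sum => x.
suff [c Bc] : exists c : 'I_#|I| -> F, bounds (<< x >> - \sum_i c i *: v i).
  exists (fun i => coeff x z * c i).
  under [X in _ - X]eq_bigr do rewrite -scalerA.
  by rewrite -scaler_sumr -scalerBr; exact: boundsZ.
have [w ->] := g_gen x; elim: w => [|j w [c Bc]] {x}.
  exists (fun=> 0); rewrite big_nil big1 ?subr0; last first.
    by move=> i _; rewrite scale0r.
 by have := bounds_mul 1%g 1%g; rewrite mulg1 subrr add0r.
exists (fun i => (i == enum_rank j)%:R + c i); rewrite big_cons.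
under [X in _ - X]eq_bigr do rewrite scalerDl.
rewrite big_split /= (bigD1 (enum_rank j)) //= eqxx scale1r.
rewrite [X in _ + X + _]big1 ?addr0; last first.
  by move=> i /negPf ->; rewrite scale0r.
have := boundsD (boundsZ (-1) (bounds_mul (g j) (\prod_(i <- w) g i)%g)) Bc.
congr bounds; rewrite /v enum_rankK scaleN1r !opprD opprK.
by rewrite addrACA (addrAC (- _)) addNr add0r.
Qed.

Lemma H1_basis : finitely_generated G ->
  exists v : 'I_(H1_dim F G) -> chains, quotient_basis setT bounds v.
Proof.
move=> [I [g /generators_span v_span]].
have [n [w w_basis]] := quotient_basis_exists bounds_linear v_span.
rewrite -H1_cyclesE.
apply: (@xgetPex _ 0%N [set n | exists v : 'I_n -> chains,
  quotient_basis (@H1_cycles F G) bounds v]).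
by rewrite H1_cyclesE; exists n, w.
Qed.

End FirstHomology.

(** This is Hom(G, F) = Hom(H_1(G; F), F) in coordinates.  Given prescribed
    values a on the basis, the map that pairs the coordinates of the class of x
    with a is additive, because coordinates are unique and
    [y] - [xy] + [x] is a boundary. *)
Lemma quotient_basis_dual (F : fieldType) (G : groupType) n
    (v : 'I_n -> {freeg G / F}) :
  quotient_basis setT (@H1_boundaries F G) v ->
  set_bij (additive_maps G F) [set: {ffun 'I_n -> F}]
    (fun f => [ffun i => fglift (f : G -> F^o) (v i)]).
Proof.
move=> [_ v_basis].
have expand (f : G -> F^o) z c : additive_maps G F f ->
    H1_boundaries (z - \sum_i c i *: v i) ->
    fglift f z = \sum_i c i * fglift f (v i).
  move=> f_add /(bounds_vanish (V := F^o) f_add).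
  rewrite linearB linear_sum => /subr0_eq ->.
  by apply: eq_bigr => i _; rewrite linearZ.
split=> //.
- move=> f h /set_mem f_add /set_mem h_add /ffunP fh.
  apply/funext => x; have [c [Bc _]] := v_basis << x >> I.
  have fE (f' : G -> F^o) : f' x = fglift f' << x >> by rewrite liftU scale1r.
  rewrite (fE f) (fE h) !(expand _ _ c) //; apply: eq_bigr => i _; congr (_ * _).
  by have := fh i; rewrite !ffunE.
- move=> a _.
  have coord z : exists c : {ffun 'I_n -> F}, H1_boundaries (z - \sum_i c i *: v i).
    by have [c [Bc _]] := v_basis z I; exists c.
  have [k kB] := choice coord.
  have kU z c : H1_boundaries (z - \sum_i c i *: v i) -> forall i, k z i = c i.
    move=> Bc; have [c0 [_ c0U]] := v_basis z I.
    have <- : c0 = k z by exact: c0U.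
    have -> : c0 = [ffun i => c i].
      by apply: c0U; under eq_bigr do rewrite ffunE.
    by move=> i; rewrite ffunE.
  pose f x : F^o := \sum_i k << x >> i * a i.
  have f_add : additive_maps G F f.
    move=> x y; rewrite /f -big_split; apply: eq_bigr => i _; rewrite /= -mulrDl.
    congr (_ * _); apply: (kU << (x * y)%g >> (fun i => k << x >> i + k << y >> i)).
    have := boundsD (boundsD (kB << x >>) (kB << y >>))
      (boundsZ (-1) (bounds_mul F x y)).
    congr H1_boundaries.
    under [in RHS]eq_bigr do rewrite scalerDl.
    rewrite big_split scaleN1r /= !opprD opprK.
    have AC (X Y Z S T : {freeg G / F}) :
        X - S + (Y - T) + (- Y + Z - X) = Z + (- S - T).
      rewrite (addrACA X) (addrAC (- Y)) -(opprD Y) (addrC Y).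
      by rewrite [LHS]addrC (addrACA (- (X + Y))) addNr add0r.
    exact: AC.
  exists f => //; apply/ffunP => j; rewrite ffunE.
  have k0 i : k 0 i = 0.
    apply: (kU 0 (fun=> 0)); rewrite sub0r -scaleN1r; apply: boundsZ.
    by rewrite big1 => [|l _]; [exact: bounds0 | rewrite scale0r].
  have kP c u w i : k (c *: u + w) i = c * k u i + k w i.
    apply: (kU _ (fun i => c * k u i + k w i)).
    have := bounds_linear c (kB u) (kB w); congr H1_boundaries.
    under [in RHS]eq_bigr do rewrite scalerDl -scalerA.
    by rewrite big_split /= -scaler_sumr scalerBr opprD addrACA.
  have fE z : fglift f z = \sum_i k z i * a i.
    rewrite [z]freeg_expand; elim: (dom z) => [|x r IHr].
      by rewrite big_nil linear0 big1 // => i _; rewrite k0 mul0r.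
    rewrite big_cons linearP /= IHr liftU scale1r.
    under [in RHS]eq_bigr do rewrite kP mulrDl -mulrA.
    by rewrite big_split /= -mulr_sumr.
  rewrite fE (bigD1 j) //= big1 => [|i ij].
    rewrite addr0 (kU _ (fun i => (i == j)%:R)) ?eqxx ?mul1r //.
    rewrite (bigD1 j) //= eqxx scale1r big1 ?addr0 ?subrr; first exact: bounds0.
    by move=> i /negPf ->; rewrite scale0r.
  rewrite (kU _ (fun i => (i == j)%:R)) ?(negPf ij) ?mul0r //.
  rewrite (bigD1 j) //= eqxx scale1r big1 ?addr0 ?subrr; first exact: bounds0.
  by move=> l /negPf ->; rewrite scale0r.
Qed.

Lemma card_additive_maps q (G : groupType) : prime q -> finitely_generated G ->
  additive_maps G 'F_q #= `I_(q ^ b1 q G).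
Proof.
move=> q_prime /(H1_basis 'F_q)[v /quotient_basis_dual v_bij].
apply: card_eq_trans (set_bij_card v_bij) _.
apply: card_eq_trans (card_finType _) _.
by rewrite card_ffun card_Fp // card_ord.
Qed.

(** * Subgroups and coset labellings *)

Section Subgroups.
Variable G : groupType.
Implicit Types (K H : subgroup G) (x y : G).

Lemma subgroup1 K : subgroup_set K 1%g.
Proof. by have [/set_mem] := subgroup_closed K. Qed.

Lemma subgroupM K x y :
  subgroup_set K x -> subgroup_set K y -> subgroup_set K (x * y)%g.
Proof.
move=> Kx Ky; apply/set_mem/(group_closedM (subgroup_closed K)); exact: mem_set.
Qed.

Lemma subgroupV K x : subgroup_set K x -> subgroup_set K x^-1%g.
Proof.
move=> Kx; apply/set_mem/(group_closedV (subgroup_closed K)); exact: mem_set.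
Qed.

Lemma subgroup_ext K H : subgroup_set K = subgroup_set H -> K = H.
Proof.
case: K H => [A Ac] [B Bc] /= AB; case: _ / AB Bc => Bc.
by congr Subgroup; exact: Prop_irrelevance.
Qed.

Lemma setT_closed : group_closed (mem [set: G]).
Proof. by split=> [|x y _ _]; rewrite inE. Qed.

(** Total, with an arbitrary value on sets that are not subgroups, so that it
    can be used as the map whose fibers are counted. *)
Definition subgroup_of (A : set G) : subgroup G :=
  if pselect (group_closed (mem A)) is left Ac then Subgroup Ac
  else Subgroup setT_closed.

Lemma subgroup_ofE (A : set G) : A 1%g ->
    (forall x y, A x -> A y -> A (x * y^-1)%g) ->
  subgroup_set (subgroup_of A) = A.
Proof.
move=> A1 AB; rewrite /subgroup_of; case: pselect => // -[]; split.
  exact: mem_set.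
by move=> x y /set_mem Ax /set_mem Ay; apply/mem_set/AB.
Qed.

Definition left_coset K x : set G := [set (x * h)%g | h in subgroup_set K].

Lemma left_cosetP K x y :
  left_coset K x = left_coset K y <-> subgroup_set K (x^-1 * y)%g.
Proof.
split=> [xy|Kxy].
  have : left_coset K y y by exists 1%g; rewrite ?mulg1 //; exact: subgroup1.
  by rewrite -xy => -[h Kh <-]; rewrite mulKg.
apply/seteqP; split=> _ [h Kh <-].
  exists ((x^-1 * y)^-1 * h)%g; first by apply: subgroupM => //; exact: subgroupV.
  by rewrite invgM invgK !mulgA mulgV mul1g.
exists ((x^-1 * y) * h)%g; first exact: subgroupM.
by rewrite !mulgA mulgV mul1g.
Qed.

(** A bijection from the left cosets of K to T, seen as a function on G. *)
Definition coset_labelling (T : Type) K (c : G -> T) :=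
  (forall a, exists x, c x = a) /\
  (forall x y, c x = c y <-> subgroup_set K (x^-1 * y)%g).

Lemma has_indexP (T : finType) n K : #|T| = n ->
  has_index n K <-> exists c : G -> T, coset_labelling K c.
Proof.
move=> <-; split=> [idx | [c [c_onto cP]]].
  have : left_cosets K #= [set: T].
    by apply: card_eq_trans idx _; apply: card_esym; exact: card_finType.
  move=> /card_bijP[f [g fK gK]].
  have cosetP x : left_coset K x \in left_cosets K by rewrite inE; exists x.
  pose c x := set_val (f (SigSub (cosetP x))).
  exists c; split=> [a | x y].
    have aT : a \in [set: T] by rewrite inE.
    have [x _ gx] := set_valP (g (SigSub aT)).
    exists x; rewrite /c; have -> : SigSub (cosetP x) = g (SigSub aT).
      by apply: val_inj.
    by rewrite gK.
  rewrite -left_cosetP; split=> [/val_inj/(can_inj fK)/(congr1 val) //|xy].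
  by congr (set_val (f _)); apply: val_inj.
have [r rK] := choice c_onto.
apply: card_eq_trans (card_finType T); apply: card_esym.
apply: (@set_bij_card _ _ _ _ (fun a => left_coset K (r a))).
split=> [a _ | a b _ _ /left_cosetP/cP | _ [x _ <-]].
- by exists (r a).
- by rewrite !rK.
- by exists (c x) => //; apply/left_cosetP/cP; rewrite rK.
Qed.

End Subgroups.

(** * Affine maps *)

(** These are the translation parts of the homomorphisms from G to the group
    of affine maps of M with linear part 1 or -1, that is, the cocycles for
    some sign character of G. *)
Definition affine_map (G : groupType) (M : zmodType) (phi : G -> M) :=
  forall x, (forall y, phi (x * y)%g = phi x + phi y) \/
            (forall y, phi (x * y)%g = phi x - phi y).

Definition onto (T U : Type) (f : T -> U) := forall a, exists x, f x = a.

Definition zero_set (T : Type) (M : zmodType) (f : T -> M) : set T := [set x | f x = 0].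

(** Every permutation of M is x |-> a + x or x |-> a - x.  Among zmodules this
    singles out those with at most three elements, which is why only
    indices two and three have such a simple count. *)
Definition rigid (M : zmodType) :=
  forall s : M -> M, injective s -> s 0 = 0 -> (s =1 id) \/ (s =1 -%R).

Section AffineMaps.
Variables (G : groupType) (M : zmodType).
Implicit Types (phi c : G -> M) (K : subgroup G).

Lemma additive_affine phi : additive_maps G M phi -> affine_map phi.
Proof. by move=> phi_add x; left. Qed.

Lemma affine1 phi : affine_map phi -> phi 1%g = 0.
Proof.
move=> /(_ 1%g)[|] /(_ 1%g); rewrite mulg1; last by rewrite subrr.
by move=> /eqP; rewrite -subr_eq subrr => /eqP.
Qed.

Lemma affine_eq phi x y : affine_map phi ->
  phi x = phi y <-> phi (x^-1 * y)%g = 0.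
Proof.
move=> phi_aff.
have -> : phi y = phi (x * (x^-1 * y))%g by rewrite mulVKg.
case: (phi_aff x) => ->; split=> [/eqP|->]; rewrite ?addr0 ?subr0 //.
  by rewrite -subr_eq0 opprD addrA subrr sub0r oppr_eq0 => /eqP.
by rewrite -subr_eq0 opprB addrC subrK => /eqP.
Qed.

Lemma zero_subgroupE phi : affine_map phi ->
  subgroup_set (subgroup_of (zero_set phi)) = zero_set phi.
Proof.
move=> phi_aff; apply: subgroup_ofE; first exact: affine1.
move=> x y /= x0 y0.
have : phi y^-1%g = 0 by rewrite -[y^-1%g]mulg1 -affine_eq // affine1.
by rewrite /zero_set /=; case: (phi_aff x) => -> ->; rewrite x0 ?addr0 ?subr0.
Qed.

Lemma affine_labelling phi : affine_map phi -> onto phi ->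
  coset_labelling (subgroup_of (zero_set phi)) phi.
Proof.
by move=> phi_aff phi_onto; split=> // x y; rewrite zero_subgroupE //; exact: affine_eq.
Qed.

Lemma labelling_zero_set K c : coset_labelling K c -> c 1%g = 0 ->
  subgroup_set K = zero_set c.
Proof.
move=> [_ cP] c1; apply/seteqP; split=> x; rewrite /zero_set /= -c1.
  by move=> Kx; apply/esym/cP; rewrite invg1 mul1g.
by move=> /esym/cP; rewrite invg1 mul1g.
Qed.

(** Two labellings of the same cosets differ by a permutation of the labels,
    which fixes 0 because both give K the label 0. *)
Lemma labelling_unique K c c' : rigid M ->
  coset_labelling K c -> c 1%g = 0 -> coset_labelling K c' -> c' 1%g = 0 ->
  c' =1 c \/ c' =1 \- c.
Proof.
move=> M_rigid [c_onto cP] c1 [_ c'P] c'1.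
(* r chooses a representative of each coset, so c' \o r is that permutation. *)
have [r rK] := choice c_onto.
have c'E x : c' x = c' (r (c x)) by apply/c'P/cP; rewrite rK.
case: (M_rigid (c' \o r)) => [a b /c'P/cP | | s_id | s_opp].
- by rewrite !rK.
- by rewrite /= -[X in r X]c1 -c'E.
- by left=> x; rewrite c'E; exact: s_id.
- by right=> x; rewrite c'E; exact: s_opp.
Qed.

(** The relabelling y |-> c (x * y) - c x induced by left multiplication by x
    is again a normalized labelling of the cosets of K. *)
Lemma labelling_affine K c : rigid M -> coset_labelling K c -> c 1%g = 0 ->
  affine_map c.
Proof.
move=> M_rigid cK c1 x; have [c_onto cP] := cK.
have xK : coset_labelling K (fun y => c (x * y)%g - c x).
  split=> [a | y z].
    have [y cy] := c_onto (a + c x).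
    by exists (x^-1 * y)%g; rewrite mulVKg cy addrK.
  split=> [/addIr/cP|/cP]; first by rewrite invgM -mulgA mulKg.
  by move=> /cP h; congr (_ - _); apply/cP; rewrite invgM -mulgA mulKg.
have := labelling_unique M_rigid cK c1 xK.
rewrite mulg1 subrr => /(_ erefl)[] h; [left | right] => y;
  by have := h y; rewrite /= => <-; rewrite addrC subrK.
Qed.

Lemma labelling_normalize K c : coset_labelling K c ->
  exists2 c' : G -> M, coset_labelling K c' & c' 1%g = 0.
Proof.
move=> [c_onto cP]; exists (fun x => c x - c 1%g); last exact: subrr.
split=> [a | x y]; first by have [x cx] := c_onto (a + c 1%g); exists x; rewrite cx addrK.
by rewrite -cP; split=> [/addIr //| ->].
Qed.

End AffineMaps.

Lemma F2_cases (a : 'F_2) : a = 0 \/ a = 1.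
Proof. by case: a => [[|[|//]] ?]; [left | right]; apply/val_inj. Qed.

Lemma F3_cases (a : 'F_3) : [\/ a = 0, a = 1 | a = -1].
Proof.
by case: a => [[|[|[|//]]] ?]; [apply: Or31 | apply: Or32 | apply: Or33]; apply/val_inj.
Qed.

Lemma F2_opp (a : 'F_2) : - a = a.
Proof. by case: (F2_cases a) => ->; apply/val_inj. Qed.

Lemma F3_triple (a : 'F_3) : a + a + a = 0.
Proof. by case: (F3_cases a) => ->; apply/val_inj. Qed.

Lemma F3_double (a : 'F_3) : a + a = 0 -> a = 0.
Proof. by move=> a2; rewrite -[LHS]add0r -a2 F3_triple. Qed.

Lemma F2_rigid : rigid 'F_2.
Proof.
move=> s s_inj s0; left=> a; case: (F2_cases a) => -> //=.
by case: (F2_cases (s 1)) => // s1; have := s_inj 1 0; rewrite s1 s0 => /(_ erefl).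
Qed.

Lemma F3_rigid : rigid 'F_3.
Proof.
move=> s s_inj s0.
have s1 : s 1 <> 0 by rewrite -s0 => /s_inj.
have sN1 : s (-1) <> 0 by rewrite -s0 => /s_inj.
have s_neq : s 1 <> s (-1) by move=> /s_inj.
case: (F3_cases (s 1)) (F3_cases (s (-1))) s1 sN1 s_neq => [] E1 [] E2;
  rewrite E1 E2 // => _ _ _; [left | right] => a; case: (F3_cases a) => ->;
  rewrite ?s0 ?E1 ?E2 ?oppr0 ?opprK //.
Qed.

Lemma F3_additive_onto (G : groupType) (f : G -> 'F_3) x :
  additive_maps G 'F_3 f -> f x <> 0 -> onto f.
Proof.
move=> f_add fx a.
have : [\/ a = 0, a = f x | a = - f x].
  case: (F3_cases (f x)) (F3_cases a) fx => [] -> [] -> // _;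
    rewrite ?opprK; first [exact: Or31 | exact: Or32 | exact: Or33].
case=> ->; [exists 1%g | exists x | exists x^-1%g] => //.
  exact: additive_map1.
exact: additive_mapV.
Qed.

Lemma F2_additive_onto (G : groupType) (f : G -> 'F_2) x :
  additive_maps G 'F_2 f -> f x <> 0 -> onto f.
Proof.
move=> f_add fx a.
have fx1 : f x = 1 by case: (F2_cases (f x)).
case: (F2_cases a) => ->; [exists 1%g; exact: additive_map1 | by exists x].
Qed.

(** * Subgroups of index two *)

Lemma index2_label (G : groupType) (K : subgroup G) : has_index 2 K ->
  exists e : G -> 'F_2, [/\ additive_maps G 'F_2 e, onto e & subgroup_set K = zero_set e].
Proof.
move=> /(has_indexP _ (card_Fp (p := 2) isT))[c0 /labelling_normalize[e eK e1]].
exists e; split.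
- move=> x y; case: (labelling_affine F2_rigid eK e1 x) => -> //.
  by rewrite F2_opp.
- by case: eK.
- exact: labelling_zero_set.
Qed.

Lemma card_index2 (G : groupType) : finitely_generated G ->
  [set K : subgroup G | has_index 2 K] #= `I_(2 ^ b1 2 G - 1).
Proof.
move=> G_fg.
have := card_setD_II (card_additive_maps (q := 2) isT G_fg)
  (card_set1 (x := (fun=> 0) : G -> 'F_2)).
have sub : [set (fun=> 0) : G -> 'F_2] `<=` additive_maps G 'F_2.
  by move=> _ -> x y; rewrite addr0.
move=> /(_ sub); apply: card_eq_trans; apply: card_esym.
have nonzero (e : G -> 'F_2) : e <> (fun=> 0) -> exists x, e x <> 0.
  by move=> e0; apply: contra_notP e0 => /forallNP e0; apply/funext => x; apply: contrapT.
apply: (@set_bij_card _ _ _ _ (fun e => subgroup_of (zero_set e))); split.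
- move=> e [e_add /nonzero[x ex]] /=.
  apply/(has_indexP _ (card_Fp (p := 2) isT)); exists e.
  apply: affine_labelling; first exact: additive_affine.
  exact: F2_additive_onto ex.
- move=> e e' /set_mem[e_add /nonzero[x ex]] /set_mem[e'_add /nonzero[x' ex']] ee'.
  have lab := affine_labelling (additive_affine e_add) (F2_additive_onto e_add ex).
  have lab' := affine_labelling (additive_affine e'_add) (F2_additive_onto e'_add ex').
  rewrite -ee' in lab'; apply/funext => y.
  have [e1 e'1] := (additive_map1 e_add, additive_map1 e'_add).
  case: (labelling_unique F2_rigid lab e1 lab' e'1) => -> //.
  by rewrite /= F2_opp.
- move=> K /index2_label[e [e_add e_onto KE]]; exists e; last first.
    by apply: subgroup_ext; rewrite zero_subgroupE //; exact: additive_affine.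
  split=> // e0; have [x] := e_onto 1; by rewrite e0.
Qed.

(* e is the projection of G onto G / K, and t represents the other coset. *)
Section IndexTwo.
Variables (G : groupType) (K : subgroup G) (e : G -> 'F_2) (t : G).
Hypotheses (e_add : additive_maps G 'F_2 e) (KE : subgroup_set K = zero_set e)
  (et : e t = 1).

Let inK x : (x \in subgroup_set K) = (e x == 0).
Proof. by rewrite KE /zero_set; apply/idP/eqP; rewrite inE. Qed.

Let eV x : e x^-1%g = e x.
Proof. by rewrite (additive_mapV e_add) F2_opp. Qed.

Let eM x y : (e (x * y)%g == 0) = ((e x == 0) == (e y == 0)).
Proof. by rewrite e_add; case: (F2_cases (e x)) (F2_cases (e y)) => -> [] ->. Qed.

Let e_t : (e t == 0) = false.
Proof. by rewrite et. Qed.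

Lemma index2_normal : normal_subgroup K.
Proof.
move=> x y /mem_set; rewrite inK => /eqP ex; apply: set_mem.
by rewrite inK conjgE !eM eV ex eqxx; case: (e y == 0).
Qed.

Definition restr (M : Type) (f : G -> M) : subgroup_type K -> M := fun k => f (val k).

Let into (x : G) : subgroup_type K := insubd (1%g : subgroup_type K) x.

Let intoK x : x \in subgroup_set K -> val (into x) = x.
Proof. by move=> Kx; rewrite val_insubd Kx. Qed.

Let into_mul x y : x \in subgroup_set K -> y \in subgroup_set K ->
  into (x * y)%g = (into x * into y)%g.
Proof.
move=> Kx Ky; apply: val_inj; rewrite gmulfM /= !intoK //.
by move: Kx Ky; rewrite !inK eM => -> ->.
Qed.

Let rep (x : G) : G := if x \in subgroup_set K then 1%g else t.

(** Schreier's argument for the transversal 1, t, whose members are r false and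
    r true: reading a word from left to right and inserting
    (rep u)^-1 * rep u after each partial product u rewrites it as a product
    of Schreier generators followed by a representative. *)
Lemma index2_generated :
  finitely_generated G -> finitely_generated (subgroup_type K).
Proof.
move=> [I [g g_gen]].
pose r (b : bool) : G := if b then t else 1%g.
have repK x : (x * (rep x)^-1)%g \in subgroup_set K.
  rewrite inK eM eV /rep inK; case: (e x == 0); last by rewrite e_t.
  by rewrite (additive_map1 e_add).
exists (bool * I)%type,
  (fun p => into (r p.1 * g p.2 * (rep (r p.1 * g p.2))^-1)%g) => k.
suff [w wE] : exists w : seq (bool * I),
    (r false * val k)%g = (val (\prod_(p <- w)
        into (r p.1 * g p.2 * (rep (r p.1 * g p.2))^-1)%g)%g
       * rep (r false * val k))%g.
  exists w; apply: val_inj; rewrite -[LHS]mul1g [LHS]wE.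
  have -> : rep (r false * val k)%g = 1%g by rewrite /rep /r mul1g (valP k).
  exact: mulg1.
have [w ->] := g_gen (val k).
(* The first coset is generalized: it changes along the word. *)
elim: w (false) => [|i w IHw] b.
  exists [::]; rewrite !big_nil !mulg1 gmulf1 mul1g /rep inK.
  by case: b; rewrite /= ?e_t // (additive_map1 e_add) eqxx.
have [b' rb'] : exists b', rep (r b * g i) = r b'.
  by rewrite /rep; case: ifP; [exists false | exists true].
have [w' w'E] := IHw b'; exists ((b, i) :: w').
rewrite !big_cons gmulfM /= intoK ?repK //= rb'.
have -> : (r b * (g i * \prod_(j <- w) g j) =
    (r b * g i * (r b')^-1) * (r b' * \prod_(j <- w) g j))%g.
  by rewrite !mulgA mulgVK.
have -> : rep (r b * g i * (r b')^-1 * (r b' * \prod_(j <- w) g j))%g =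
          rep (r b' * \prod_(j <- w) g j)%g.
  have := repK (r b * g i)%g; rewrite rb' inK => /eqP e0.
  by rewrite /rep !inK e_add e0 add0r.
by rewrite {1}w'E mulgA.
Qed.

(** * Cocycles of a sign character *)

Section Transfer.
Variables (R : comNzRingType) (s : R).
Hypothesis ss : s * s = 1.

Definition twisted (phi : G -> R) := forall x y,
  phi (x * y)%g = phi x + (if x \in subgroup_set K then 1 else s) * phi y.

(** For s = 1 this is the transfer from K to G of the homomorphism h, computed
    with the transversal 1, t; for s = -1 it is its analogue for cocycles with
    values in the sign representation of G / K. *)
Definition transfer (h : subgroup_type K -> R) (x : G) : R :=
  if x \in subgroup_set K then h (into x) + s * h (into (t * x * t^-1)%g)
  else h (into (x * t^-1)%g) + s * h (into (t * x)%g).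

Lemma transfer_twisted h :
  additive_maps (subgroup_type K) R h -> twisted (transfer h).
Proof.
move=> h_add x y; rewrite /transfer.
have hM u v : e u = 0 -> e v = 0 -> h (into (u * v)%g) = h (into u) + h (into v).
  by move=> eu ev; rewrite -h_add into_mul // inK ?eu ?ev eqxx.
have ef z : (e z == 0) = false -> e z = 1.
  by case: (F2_cases (e z)) => ->.
have t11 : 1 + 1 = 0 :> 'F_2 by apply/val_inj.
have Kc z : e z = 0 -> e (t * z * t^-1)%g = 0.
  by move=> ez; rewrite !e_add eV et ez addr0 t11.
have Kl z : e z = 1 -> e (t * z)%g = 0 by move=> ez; rewrite e_add et ez t11.
have Kr z : e z = 1 -> e (z * t^-1)%g = 0 by move=> ez; rewrite e_add eV et ez t11.
rewrite !inK eM; case: (e x =P 0) => [ex|/eqP/negPf/ef ex];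
  case: (e y =P 0) => [ey|/eqP/negPf/ef ey] /=.
- have -> : (t * (x * y) * t^-1 = (t * x * t^-1) * (t * y * t^-1))%g.
    by rewrite !mulgA mulgVK.
  rewrite (hM x y) // hM ?Kc //; ring.
- have -> : (t * (x * y) = (t * x * t^-1) * (t * y))%g by rewrite !mulgA mulgVK.
  rewrite -mulgA (hM x) ?Kr // hM ?Kc ?Kl //; ring.
- have -> : (x * y * t^-1 = (x * t^-1) * (t * y * t^-1))%g by rewrite !mulgA mulgVK.
  rewrite (mulgA t) (hM (x * t^-1)%g) ?Kc ?Kr // (hM (t * x)%g) ?Kl //.
  rewrite [s * (_ + s * _)]mulrDr [s * (s * _)]mulrA ss; ring.
- have -> : (t * (x * y) * t^-1 = (t * x) * (y * t^-1))%g by rewrite !mulgA.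
  have -> : (x * y = (x * t^-1) * (t * y))%g by rewrite !mulgA mulgVK.
  rewrite (hM (x * t^-1)%g) ?Kr ?Kl // (hM (t * x)%g) ?Kr ?Kl //.
  rewrite [s * (_ + s * _)]mulrDr [s * (s * _)]mulrA ss; ring.
Qed.

End Transfer.

Let onK (M : zmodType) (phi : G -> M) : Prop :=
  forall k : G, k \in subgroup_set K -> phi k = 0.

Let K1 : 1%g \in subgroup_set K.
Proof. exact/mem_set/subgroup1. Qed.

Let Kt : (t \in subgroup_set K) = false.
Proof. by rewrite inK e_t. Qed.

Let Ktt : (t * t)%g \in subgroup_set K.
Proof. by rewrite inK eM e_t. Qed.

Lemma twisted1 (R : comNzRingType) (s : R) phi : twisted s phi -> phi 1%g = 0.
Proof.
by move=> phi_tw; apply: (addrI (phi 1%g)); rewrite addr0 -{3}[1%g]mulg1 phi_tw K1 mul1r.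
Qed.

(** A cocycle that vanishes on K is constant on the other coset. *)
Lemma twisted_vanish (R : comNzRingType) (s : R) phi x : twisted s phi -> onK phi ->
  x \notin subgroup_set K -> phi x = phi t.
Proof.
move=> phi_tw phi0 Kx; rewrite -[x](mulVKg t) phi_tw Kt (phi0 (t^-1 * x)%g) ?mulr0 ?addr0 //.
by move: Kx; rewrite !inK eM eV e_t; case: (e x == 0).
Qed.

Lemma additive_twisted (R : comNzRingType) (psi : G -> R) :
  additive_maps G R psi <-> twisted 1 psi.
Proof.
by split=> H x y; have := H x y; case: (x \in subgroup_set K); rewrite mul1r.
Qed.

Lemma twisted_additiveK (R : comNzRingType) (s : R) phi : twisted s phi ->
  additive_maps (subgroup_type K) R (restr phi).
Proof. by move=> phi_tw x y; rewrite /restr gmulfM phi_tw (valP x) mul1r. Qed.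

(** The second component records the part of the cocycle that its restriction
    to K does not see. *)
Definition cochain_sum (p : (G -> 'F_3) * (G -> 'F_3)) :=
  (restr (fun x => p.1 x + p.2 x), p.2 t).

Lemma twistedB (R : comNzRingType) (s : R) phi phi' :
  twisted s phi -> twisted s phi' -> twisted s (phi \- phi').
Proof. move=> tw tw' x y; rewrite /= tw tw'; case: ifP => _; ring. Qed.

(** On K, psi is invariant and phi is anti-invariant under conjugation by t.
    If they are opposite there, both vanish on K, as 2 is invertible. *)
Lemma cochain_sum_inj (psi phi : G -> 'F_3) : twisted 1 psi -> twisted (-1) phi ->
  (forall k, k \in subgroup_set K -> psi k + phi k = 0) -> phi t = 0 ->
  psi =1 (fun=> 0) /\ phi =1 (fun=> 0).
Proof.
move=> psi_tw phi_tw sum0 phit.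
have phi0 : onK phi.
  move=> k Kk.
  have KtV : (t^-1%g \in subgroup_set K) = false by rewrite inK eV e_t.
  have Kc : (t * (k * t^-1))%g \in subgroup_set K.
    by move: Kk; rewrite !inK !eM eV e_t => ->.
  have phitV : phi t^-1%g = 0.
    have := phi_tw t t^-1%g; rewrite mulgV Kt (twisted1 phi_tw) phit.
    by rewrite add0r mulN1r => /esym/eqP; rewrite oppr_eq0 => /eqP.
  have psitV : psi t^-1%g = - psi t.
    apply/eqP; rewrite -addr_eq0 addrC; apply/eqP.
    by have := psi_tw t t^-1%g; rewrite mulgV Kt (twisted1 psi_tw) mul1r.
  have := sum0 _ Kc; rewrite !psi_tw !phi_tw Kk Kt phitV psitV phit.
  have := sum0 _ Kk; move: (psi k) (phi k) (psi t) => a b c ab0 h.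
  apply: F3_double; rewrite -[RHS]ab0; apply/eqP; rewrite -subr_eq0; apply/eqP.
  rewrite -[RHS]oppr0 -[in RHS]h; ring.
have psi0 : onK psi by move=> k Kk; have := sum0 k Kk; rewrite phi0 // addr0.
have psit : psi t = 0.
  by apply: F3_double; have := psi_tw t t; rewrite Kt mul1r psi0.
by split=> x; have [/[dup] /psi0 ? /phi0 ? //|Kx] := boolP (x \in subgroup_set K);
  rewrite ?(twisted_vanish psi_tw psi0 Kx) ?(twisted_vanish phi_tw phi0 Kx).
Qed.

(** Injectivity is the kernel computation above, applied to differences.  For
    surjectivity, transfer from K to G followed by restriction sends h to
    h + h^t, and its twisted analogue sends h to h - h^t; their sum is 2 * h,
    that is - h over 'F_3. *)
Lemma cochain_sum_bij :
  set_bij (additive_maps G 'F_3 `*` twisted (-1))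
    (additive_maps (subgroup_type K) 'F_3 `*` setT) cochain_sum.
Proof.
split.
- move=> [psi phi] [/= /additive_twisted psi_tw phi_tw]; split=> //=.
  have psiK := twisted_additiveK psi_tw; have phiK := twisted_additiveK phi_tw.
  by move=> x y; rewrite /restr -/(restr psi _) -/(restr phi _) psiK phiK addrACA.
- move=> [psi phi] [psi' phi'] /set_mem[/= /additive_twisted psi_tw phi_tw].
  move=> /set_mem[/= /additive_twisted psi_tw' phi_tw'] [sumE phitE].
  have psiB := twistedB psi_tw psi_tw'; have phiB := twistedB phi_tw phi_tw'.
  have [k Kk||psiE phiE] := cochain_sum_inj psiB phiB.
  + have := congr1 (@^~ (into k)) sumE; rewrite /restr /= intoK // => sumk.
    by apply/eqP; rewrite addrACA -opprD subr_eq0 sumk.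
  + by rewrite /= phitE subrr.
  + by congr (_, _); apply/funext => x; apply: subr0_eq; [exact: psiE | exact: phiE].
- move=> [h c] [/= h_add _].
  have one1 : 1 * 1 = 1 :> 'F_3 by rewrite mulr1.
  have oneN : -1 * -1 = 1 :> 'F_3 by rewrite mulrNN mulr1.
  have V_tw := transfer_twisted one1 h_add.
  have W_tw := transfer_twisted oneN h_add.
  (* The coboundary with value d outside K adjusts the value at t to c. *)
  pose d := c + transfer (-1) h t.
  pose psi x := - transfer 1 h x.
  pose phi x := - transfer (-1) h x + (if x \in subgroup_set K then 0 else d).
  exists (psi, phi).
    split=> /=.
      apply/additive_twisted => x y; rewrite /psi V_tw; case: ifP => _; ring.
    move=> x y; rewrite /phi W_tw !inK eM.
    case: (e x == 0); case: (e y == 0) => /=; ring.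
  congr (_, _); last by rewrite /= /phi Kt /d; ring.
  apply/funext => k; rewrite /restr /psi /phi /transfer /= (valP k).
  have -> : into (val k) = k by apply: val_inj; rewrite intoK // (valP k).
  move: (h k) (h (into _)) => a b.
  rewrite -[RHS]add0r -[X in _ = X + _](F3_triple (- a)); ring.
Qed.

Lemma card_coboundaries : [set phi : G -> 'F_3 | twisted (-1) phi /\ onK phi] #= `I_3.
Proof.
have cardF := card_finType 'F_3; rewrite card_Fp // in cardF.
apply: card_eq_trans cardF; apply: (@set_bij_card _ _ _ _ (fun phi => phi t)).
split=> //.
- move=> phi phi' /set_mem[phi_tw phi0] /set_mem[phi'_tw phi'0] phit; apply/funext => x.
  case: (boolP (x \in subgroup_set K)) => Kx; first by rewrite phi0 ?phi'0.
  by rewrite (twisted_vanish phi_tw phi0 Kx) (twisted_vanish phi'_tw phi'0 Kx).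
- move=> a _; exists (fun x => if x \in subgroup_set K then 0 else a); last by rewrite Kt.
  split=> [x y | k -> //].
  by rewrite !inK eM; case: (e x == 0); case: (e y == 0) => /=; ring.
Qed.

(** The inequality of Betti numbers, which gives d >= 0, comes for free: there
    are at least three cocycles, namely those that vanish on K. *)
Lemma card_twisted : finitely_generated G ->
  (b1 3 G <= b1 3 (subgroup_type K))%N /\
  (twisted (-1) : set (G -> 'F_3)) #= `I_(3 * 3 ^ (b1 3 (subgroup_type K) - b1 3 G)).
Proof.
move=> G_fg; set m := b1 3 G; set n := b1 3 _.
have cardG := card_additive_maps (q := 3) isT G_fg.
have cardK := card_additive_maps (q := 3) isT (index2_generated G_fg).
have cardF := card_finType 'F_3; rewrite card_Fp // in cardF.
have cardP := card_eq_trans (set_bij_card cochain_sum_bij) (card_setX_II cardK cardF).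
have finZ : finite_set (twisted (-1) : set (G -> 'F_3)).
  have : finite_set (additive_maps G 'F_3 `*` (twisted (-1) : set (G -> 'F_3))).
    by apply/finite_setP; eexists; exact: cardP.
  move=> /(finite_image snd); apply: sub_finite_set => phi phi_tw.
  by exists ((fun=> 0), phi) => //; split=> //= x y; rewrite addr0.
have /finite_setP[z cardZ] := finZ.
have := card_setX_II cardG cardZ; rewrite (card_eql cardP) => /card_eq_II.
rewrite -/m -/n => zE.
have z3 : (3 <= z)%N.
  rewrite -card_le_II -(card_le_eql card_coboundaries) -(card_le_eqr cardZ).
  by apply: subset_card_le => phi [].
have mn : (m <= n)%N.
  rewrite -(leq_exp2l (m := 3)) // -(leq_pmul2r (m := 3)) // zE.
  by rewrite leq_mul2l z3 orbT.
split=> //; suff <- : z = (3 * 3 ^ (n - m))%N by [].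
apply/eqP; rewrite -(eqn_pmul2l (m := 3 ^ m)) ?expn_gt0 // -zE.
by rewrite mulnCA -expnD subnKC // mulnC.
Qed.

(** A cocycle that vanishes on K has at most the two values 0 and phi t; one
    that does not restricts to a nonzero homomorphism, which is already
    surjective on K. *)
Lemma twisted_ontoP (phi : G -> 'F_3) : twisted (-1) phi -> onto phi <-> ~ onK phi.
Proof.
move=> phi_tw; split=> [phi_onto phi0 | ].
  have vals x : phi x = 0 \/ phi x = phi t.
    case: (boolP (x \in subgroup_set K)) => Kx; first by left; rewrite phi0.
    by right; exact: twisted_vanish.
  have [x x1] := phi_onto 1; have [y y1] := phi_onto (-1).
  by case: (vals x) => Ex; case: (vals y) => Ey; move: x1 y1; rewrite Ex Ey // => ->.
move=> /existsNP[k /not_implyP[Kk phik]] a.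
have phik' : restr phi (into k) <> 0 by rewrite /restr intoK.
have [l <-] := F3_additive_onto (twisted_additiveK phi_tw) phik' a.
by exists (val l).
Qed.

Lemma card_twisted_onto : finitely_generated G ->
  [set phi : G -> 'F_3 | twisted (-1) phi /\ onto phi] #=
    `I_(3 * (3 ^ (b1 3 (subgroup_type K) - b1 3 G) - 1)).
Proof.
move=> G_fg; rewrite mulnBr muln1.
have -> : [set phi : G -> 'F_3 | twisted (-1) phi /\ onto phi] =
    twisted (-1) `\` [set phi | twisted (-1) phi /\ onK phi].
  apply/seteqP; split=> phi /= [phi_tw].
    by move=> /(twisted_ontoP phi_tw) phi0; split=> // -[].
  by move=> phi0; split=> //; apply/(twisted_ontoP phi_tw) => ?; apply: phi0.
apply: card_setD_II card_coboundaries _; first by case: (card_twisted G_fg).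
by move=> phi [].
Qed.

End IndexTwo.

(** * Subgroups of index three *)

Section IndexThree.
Variable G : groupType.
Implicit Types (K : subgroup G) (phi : G -> 'F_3).

Definition affine_onto : set (G -> 'F_3) := [set phi | affine_map phi /\ onto phi].

Lemma affine_opp phi : affine_map phi -> affine_map (\- phi).
Proof.
move=> phi_aff x; case: (phi_aff x) => h; [left | right] => y;
  by rewrite /= h ?opprD ?opprB // opprK addrC.
Qed.

Lemma zero_set_opp phi : zero_set (\- phi) = zero_set phi.
Proof.
apply/seteqP; split=> x; rewrite /zero_set /=; last by move=> ->; rewrite oppr0.
by move=> /eqP; rewrite oppr_eq0 => /eqP.
Qed.

(** The two elements of the fiber are the two normalized labellings of the
    cosets of K, c and - c. *)
Lemma index3_fiber K : has_index 3 K ->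
  affine_onto `&` (fun phi => subgroup_of (zero_set phi)) @^-1` [set K] #= `I_2.
Proof.
move=> /(has_indexP _ (card_Fp (p := 3) isT))[c0 /labelling_normalize[c cK c1]].
have c_aff := labelling_affine F3_rigid cK c1; have [c_onto _] := cK.
have KE : subgroup_of (zero_set c) = K.
  by apply: subgroup_ext; rewrite zero_subgroupE // (labelling_zero_set cK c1).
apply: card_esym; apply: card_eq_trans (card_esym _) _.
  by have := card_finType bool; rewrite card_bool; apply.
apply: (@set_bij_card _ _ _ _ (fun b : bool => if b then c else \- c)).
have [x1 cx1] := c_onto 1.
split.
- case=> _ /=; split; rewrite /= ?zero_set_opp //; split=> //.
    exact: affine_opp.
  by move=> a; have [x cx] := c_onto (- a); exists x; rewrite /= cx opprK.
- by case=> [] [] _ _ // /(congr1 (@^~ x1)) /=; rewrite cx1.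
- move=> phi [[phi_aff phi_onto] phiK].
  have := affine_labelling phi_aff phi_onto; rewrite phiK => phi_lab.
  case: (labelling_unique F3_rigid cK c1 phi_lab (affine1 phi_aff)) => phiE.
    by exists true => //; apply/funext => x; rewrite phiE.
  by exists false => //; apply/funext => x; rewrite phiE.
Qed.

Lemma affine_onto_index3 phi : affine_onto phi ->
  has_index 3 (subgroup_of (zero_set phi)).
Proof.
move=> [phi_aff phi_onto]; apply/(has_indexP _ (card_Fp (p := 3) isT)).
by exists phi; exact: affine_labelling.
Qed.

Lemma card_affine_onto n : [set K : subgroup G | has_index 3 K] #= `I_n ->
  affine_onto #= `I_(n * 2).
Proof.
move=> Xn; apply: (card_fibers_const Xn affine_onto_index3); exact: index3_fiber.
Qed.

(** The kernel of the sign character of phi, described without reference to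
    that character, which is unique when phi is surjective. *)
Definition sign_kernel phi : set G := [set x | forall y, phi (x * y)%g = phi x + phi y].

Lemma sign_kernelN phi x : affine_map phi -> ~ sign_kernel phi x ->
  forall y, phi (x * y)%g = phi x - phi y.
Proof. by move=> /(_ x)[]. Qed.

(** Outside K both signs would give 2 * phi y = 0 for all y, which surjectivity
    excludes. *)
Lemma sign_kernel_twisted K phi : onto phi -> twisted K (-1) phi ->
  sign_kernel phi = subgroup_set K.
Proof.
move=> phi_onto phi_tw; apply/seteqP; split=> x /= xP; last first.
  by move=> y; rewrite phi_tw mem_set // mul1r.
apply: contrapT => Kx; have [y y1] := phi_onto 1.
have := xP y; rewrite phi_tw memNset // mulN1r => /addrI; rewrite y1.
by move=> /eqP.
Qed.

Lemma sign_subgroupE phi : affine_map phi ->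
  subgroup_set (subgroup_of (sign_kernel phi)) = sign_kernel phi.
Proof.
move=> phi_aff; have phi1 := affine1 phi_aff; apply: subgroup_ofE.
  by move=> y; rewrite mul1g phi1 add0r.
move=> x y xP yP z.
have yV u : phi (y^-1 * u)%g = phi u - phi y by rewrite -{2}[u](mulVKg y) yP addrC addKr.
have yV1 : phi y^-1%g = - phi y by rewrite -[y^-1%g]mulg1 yV phi1 sub0r.
by rewrite -mulgA !xP yV yV1 addrAC addrA.
Qed.

(** Membership in the sign kernel is a labelling of its cosets, since a product
    of two elements of sign -1 has sign 1. *)
Lemma sign_subgroup_index phi : affine_map phi ->
  sign_kernel phi = setT \/ has_index 2 (subgroup_of (sign_kernel phi)).
Proof.
move=> phi_aff; have phi1 := affine1 phi_aff.
case: (pselect (forall x, sign_kernel phi x)) => [kerT | /existsNP[t tN]].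
  by left; apply/seteqP; split=> // x _; exact: kerT.
right; apply/(has_indexP _ (card_Fp (p := 2) isT)).
have N := sign_kernelN phi_aff.
have closed x y : sign_kernel phi x -> sign_kernel phi y -> sign_kernel phi (x * y)%g.
  by move=> xP yP z; rewrite -mulgA !xP yP addrA.
have VN x : ~ sign_kernel phi x -> forall z, phi (x^-1 * z)%g = phi x - phi z.
  move=> xN z; rewrite -[z in RHS](mulVKg x) (N x) // opprB addrC subrK //.
have NN x y : ~ sign_kernel phi x -> ~ sign_kernel phi y -> sign_kernel phi (x^-1 * y)%g.
  move=> xN yN z; rewrite -mulgA !VN // (N y) //; rewrite opprB; ring.
have V x : sign_kernel phi x -> sign_kernel phi x^-1%g.
  move=> xP; rewrite -(sign_subgroupE phi_aff); apply: subgroupV.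
  by rewrite sign_subgroupE.
exists (fun x => if x \in sign_kernel phi then 0 else 1); split=> [a | x y].
  case: (F2_cases a) => ->.
    by exists 1%g; rewrite mem_set //= => y; rewrite mul1g phi1 add0r.
  by exists t; rewrite (memNset tN).
rewrite sign_subgroupE //.
case: (boolP (x \in sign_kernel phi)) => [/set_mem xP|/negP xN];
  case: (boolP (y \in sign_kernel phi)) => [/set_mem yP|/negP yN]; split=> // h.
- by apply: closed => //; exact: V.
- by case: yN; apply: mem_set; rewrite -[y](mulVKg x); exact: closed.
- case: xN; apply: mem_set; rewrite -[x]invgK; apply: (V).
  by rewrite -[x^-1%g](mulgK y); apply: closed => //; exact: V.
- by apply: NN => [/mem_set|/mem_set].
Qed.

Lemma twisted_affine K phi : twisted K (-1) phi -> affine_map phi.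
Proof.
move=> phi_tw x; case: (boolP (x \in subgroup_set K)) => Kx; [left|right] => y;
  by rewrite phi_tw ?Kx ?(negPf Kx) ?mul1r ?mulN1r.
Qed.

Lemma sign_fiber K :
  affine_onto `&` (fun phi => subgroup_of (sign_kernel phi)) @^-1` [set K] =
  [set phi : G -> 'F_3 | twisted K (-1) phi /\ onto phi].
Proof.
apply/seteqP; split=> phi.
  move=> [[phi_aff phi_onto] <-]; split=> // x y; rewrite sign_subgroupE //.
  case: (boolP (x \in _)) => [/set_mem ->|/negP xN]; first by rewrite mul1r.
  by rewrite (sign_kernelN phi_aff) ?mulN1r // => /mem_set.
move=> [phi_tw phi_onto]; have phi_aff := twisted_affine phi_tw.
split=> //=; apply: subgroup_ext; rewrite sign_subgroupE //.
exact: sign_kernel_twisted.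
Qed.

Definition whole_group : subgroup G := subgroup_of setT.

Lemma whole_groupE : subgroup_set whole_group = setT.
Proof. exact: subgroup_ofE. Qed.

Lemma card_additive_onto : finitely_generated G ->
  [set phi : G -> 'F_3 | twisted whole_group (-1) phi /\ onto phi] #= `I_(3 ^ b1 3 G - 1).
Proof.
move=> G_fg.
have -> : [set phi : G -> 'F_3 | twisted whole_group (-1) phi /\ onto phi] =
    additive_maps G 'F_3 `\` [set (fun=> 0)].
  apply/seteqP; split=> phi /=.
    move=> [phi_tw phi_onto]; split=> [x y|phi0].
      by rewrite phi_tw whole_groupE mem_set // mul1r.
    by have [x] := phi_onto 1; rewrite phi0.
  move=> [phi_add phi0]; split=> [x y|].
    by rewrite phi_add whole_groupE mem_set // mul1r.
  have [x phix] : exists x, phi x <> 0.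
    apply: contra_notP phi0 => /forallNP phi0; apply/funext => x.
    exact: contrapT.
  exact: F3_additive_onto phix.
apply: card_setD_II; [exact: card_additive_maps | exact: card_set1 |].
by move=> _ -> x y; rewrite addr0.
Qed.

(** Surjective affine maps are counted twice, by their zero set and by their
    sign kernel. *)
Lemma num_index3_double : finitely_generated G ->
  (num_index 3 G * 2)%N =
  (3 ^ b1 3 G - 1 + \sum_(K <- fset_set [set K : subgroup G | has_index 2 K])
     3 * (3 ^ (b1 3 (subgroup_type K) - b1 3 G) - 1))%N.
Proof.
move=> G_fg; set X2 := [set K | _].
have finX2 : finite_set X2 by apply/finite_setP; eexists; exact: card_index2.
have wholeN : ~ X2 whole_group.
  move=> /index2_label[e [_ e_onto eE]]; have [x x1] := e_onto 1.
  have : zero_set e x by rewrite -eE whole_groupE.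
  by rewrite /zero_set /= x1.
pose m K := if K == whole_group then (3 ^ b1 3 G - 1)%N
  else (3 * (3 ^ (b1 3 (subgroup_type K) - b1 3 G) - 1))%N.
have card_sum : affine_onto #= `I_(\sum_(K <- fset_set (whole_group |` X2)) m K).
  apply: (card_fibers (h := fun phi => subgroup_of (sign_kernel phi))).
  - by rewrite finite_setU; split=> //; exact: finite_set1.
  - move=> phi [phi_aff _]; case: (sign_subgroup_index phi_aff) => [-> | ]; first by left.
    by right.
  - move=> K XK; rewrite sign_fiber /m.
    case: eqP => [-> | KN]; first exact: card_additive_onto.
    case: XK => [//|/index2_label[e [e_add e_onto KE]]].
    have [t et] := e_onto 1.
    exact: card_twisted_onto e_add KE et G_fg.
have [n Xn] : finite_set [set K : subgroup G | has_index 3 K].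
  have /(finite_image (fun phi => subgroup_of (zero_set phi))) : finite_set affine_onto.
    by apply/finite_setP; eexists; exact: card_sum.
  apply: sub_finite_set => K /= K3.
  have /card_set_bijP[f] := index3_fiber K3.
  case=> _ _ /(_ 0%N isT)[phi [phi_ao phiK] _]; by exists phi.
have := card_affine_onto Xn; rewrite (card_eql card_sum) => /card_eq_II.
rewrite /num_index (card_fset_set Xn) => <-.
rewrite fset_setU1 // big_fsetU1 /=; last by rewrite in_fset_set // memNset.
rewrite /m eqxx; congr (_ + _)%N; apply: eq_big_seq => K.
by rewrite in_fset_set // => /set_mem XK; case: eqP => // KE; case: wholeN; rewrite -KE.
Qed.

End IndexThree.

Theorem theorem8p2 (G : groupType) (n2 n3 : nat) :
  finitely_presented G -> n2 = b1 2 G -> n3 = b1 3 G ->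
  ((num_index 2 G)%:R = 2 ^+ n2 - 1 :> rat) /\
  ((num_index 3 G)%:R =
     1 / 2 * (3 ^+ n3 - 1)
     + 3 / 2 * \sum_(d \in [set d : nat | (1 <= d)%N]%classic)
                 ((beta 3 2 d G)%:R * (3 ^+ d - 1) : rat)).
Proof.
move=> /presented_generated G_fg -> ->; split.
  rewrite /num_index (card_fset_set (card_index2 G_fg)) natrB ?expn_gt0 //.
  by rewrite natrX.
pose X2 := [set K : subgroup G | has_index 2 K].
have finX2 : finite_set X2 by apply/finite_setP; eexists; exact: card_index2.
pose d3 (K : subgroup G) := (b1 3 (subgroup_type K) - b1 3 G)%N.
have betaE d : beta 3 2 d G = #|` fset_set [set K | X2 K /\ d3 K = d]|.
  rewrite /beta; congr (#|` fset_set _|); apply/seteqP; split=> K /=.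
    by move=> [_ XK b1E]; split=> //; rewrite /d3 b1E addKn.
  move=> [XK <-]; have [e [e_add e_onto KE]] := index2_label XK.
  have [t et] := e_onto 1; split=> //; first exact: index2_normal e_add KE.
  by rewrite /d3 subnKC //; case: (card_twisted e_add KE et G_fg).
have -> : \sum_(d \in [set d : nat | (1 <= d)%N]) ((beta 3 2 d G)%:R * (3 ^+ d - 1) : rat)
    = \sum_(K <- fset_set X2) (3 ^+ d3 K - 1).
  rewrite -(@fsum_by_value rat _ X2 d3 (fun d => 3 ^+ d - 1)) ?expr0 ?subrr //.
  by apply: eq_fsbigr => d _; rewrite betaE.
have := congr1 (fun n => n%:R : rat) (num_index3_double G_fg).
rewrite natrM natrD natrB ?expn_gt0 // natrX natr_sum.
have -> : \sum_(K <- fset_set X2) (3 * (3 ^ d3 K - 1))%N%:R =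
    3 * \sum_(K <- fset_set X2) (3 ^+ d3 K - 1) :> rat.
  rewrite mulr_sumr; apply: eq_bigr => K _.
  by rewrite natrM natrB ?expn_gt0 // natrX.
rewrite -/X2; move: (\sum_(K <- _) _) => S.
move: (num_index 3 G)%:R (b1 3 G) => a m aE; lra.
Qed.
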